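(* Let $n \geq m \geq 0$ and $p \geq \max(2n+2,n+2m+2)$ be integers. Then the following are equivalent: (i) $p < r(S(n,m))$; (ii) there exists a graph $G$ with $|V(G)|=p$ such that $\deg(v) \geq p-n-1$ for every $v \in V(G)$ and $|N(v) \cup N(u)| \leq n+m+1$ for every edge $uv \in E(G)$.
   Context: For integers $n \geq m \geq 0$, the double star $S(n,m)$ is the graph consisting of the union of two stars $K_{1,n}$ and $K_{1,m}$ together with an edge joining their centers. For a graph $H$, the Ramsey number $r(H)$ is the least integer $N$ such that every 2-coloring of the edges of $K_N$ contains a monochromatic copy of $H$. $N(v)$ denotes the neighborhood of a vertex $v$ in $G$. *)

(* Defs.v *)
From HB Require Import structures.
From mathcomp Require Import all_boot.

Set Implicit Arguments.
Unset Strict Implicit.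
Unset Printing Implicit Defensive.

Structure sgraph := SGraph {
  vertex :> finType;
  edge : rel vertex;
  edge_sym : symmetric edge;
  edge_irrefl : irreflexive edge
}.

Definition nbhd (G : sgraph) (v : G) : {set G} := [set u | edge v u].

Definition deg (G : sgraph) (v : G) : nat := #|nbhd v|.

(* A copy need not be induced. *)
Definition has_copy (H G : sgraph) : bool :=
  [exists f : {ffun H -> G},
     injectiveb f && [forall x, forall y, edge x y ==> edge (f x) (f y)]].

(* The star K_{1,k}: [None] is the center, the [Some i] are the k leaves. *)
Definition star_edge k : rel (option 'I_k) :=
  [rel x y | (x == None) (+) (y == None)].

Definition double_star_edge n m : rel (option 'I_n + option 'I_m) :=
  fun x y => match x, y with
  | inl a, inl b => star_edge a b
  | inr a, inr b => star_edge a b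
  | inl a, inr b => (a == None) && (b == None)
  | inr a, inl b => (a == None) && (b == None)
  end.

Lemma double_star_sym n m : symmetric (@double_star_edge n m).
Proof. by move=> [] a [] b //=; [exact: addbC | exact: andbC | exact: andbC | exact: addbC]. Qed.

Lemma double_star_irrefl n m : irreflexive (@double_star_edge n m).
Proof. by case=> a; apply: addbb. Qed.

Definition double_star n m : sgraph :=
  SGraph (@double_star_sym n m) (@double_star_irrefl n m).

(* A 2-coloring of the edges of K_N is a map on sets of vertices of which only
   the values on pairs [set x; y] with x != y are ever used. *)
Definition coloring N := {ffun {set 'I_N} -> bool}.

Definition color_edge N (c : coloring N) (b : bool) : rel 'I_N :=
  [rel x y | (x != y) && (c [set x; y] == b)].

Lemma color_sym N (c : coloring N) b : symmetric (color_edge c b).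
Proof. by move=> x y; rewrite /color_edge /= eq_sym setUC. Qed.

Lemma color_irrefl N (c : coloring N) b : irreflexive (color_edge c b).
Proof. by move=> x; rewrite /color_edge /= eqxx. Qed.

Definition color_class N (c : coloring N) (b : bool) : sgraph :=
  SGraph (color_sym c b) (color_irrefl c b).

Definition ramsey (H : sgraph) (N : nat) : bool :=
  [forall c : coloring N, exists b, has_copy H (color_class c b)].

Definition mono (T : finType) (c : {set T} -> bool) (b : bool) (B : {set T}) :=
  {in B &, forall x y, x != y -> c [set x; y] = b}.

Lemma ramsey_clique k l : exists N, forall (T : finType) (c : {set T} -> bool)
    (A : {set T}), N <= #|A| ->
  exists (b : bool) (B : {set T}),
    [/\ B \subset A, #|B| = (if b then k else l) & mono c b B].
Proof.
have [s] := ubnP (k + l); elim: s => // s IH in k l *.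
case: k => [|k] le_s.
  exists 0 => T c A _; exists true, set0; split; rewrite ?sub0set ?cards0 //.
  by move=> x y; rewrite inE.
case: l le_s => [|l] le_s.
  exists 0 => T c A _; exists false, set0; split; rewrite ?sub0set ?cards0 //.
  by move=> x y; rewrite inE.
have [|N1 H1] := IH k l.+1; first by rewrite addSn ltnS in le_s.
have [|N2 H2] := IH k.+1 l; first by rewrite addnS ltnS in le_s.
exists (N1 + N2).+1 => T c A leA.
have /card_gt0P[v vA] : 0 < #|A| by apply: leq_trans leA.
pose D b := [set u in A :\ v | c [set v; u] == b].
have sDA b : D b \subset A by apply/subsetP=> u; rewrite !inE -andbA => /and3P[].
have ext b (C : {set T}) : C \subset D b -> mono c b C ->
    [/\ v |: C \subset A, #|v |: C| = #|C|.+1 & mono c b (v |: C)].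
  move=> sCD hC; have Dv u : u \in C -> (u != v) && (c [set v; u] == b).
    by move=> /(subsetP sCD); rewrite !inE -andbA => /and3P[-> _ ->].
  split.
  - by rewrite subUset sub1set vA (subset_trans sCD).
  - by rewrite cardsU1; case: (boolP (v \in C)) => // /Dv; rewrite eqxx.
  - move=> x y; rewrite !inE => /orP[/eqP-> | xC] /orP[/eqP-> | yC].
    + by rewrite eqxx.
    + by move=> _; case/andP: (Dv _ yC) => _ /eqP.
    + by move=> _; rewrite setUC; case/andP: (Dv _ xC) => _ /eqP.
    + exact: hC.
have cardD : #|D true| + #|D false| = #|A :\ v|.
  rewrite -(cardsID [set u | c [set v; u]] (A :\ v)).
  congr (_ + _); apply: eq_card => u; first by rewrite !inE eqb_id.
  by rewrite !inE eqbF_neg andbC.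
have [leD|leD] : N1 <= #|D true| \/ N2 <= #|D false|.
- move: leA; rewrite (cardsD1 v) vA ltnS -cardD.
  case: (leqP N1) => [|lt1]; [by left | right].
  by rewrite -(leq_add2l N1) (leq_trans leA) // leq_add2r ltnW.
- have [[] [B [sB cB mB]]] := H1 T c _ leD.
    have [s1 c1 m1] := ext _ _ sB mB.
    by exists true, (v |: B); split; rewrite // c1 cB.
  by exists false, B; split=> //; apply: subset_trans sB _.
- have [[] [B [sB cB mB]]] := H2 T c _ leD.
    by exists true, B; split=> //; apply: subset_trans sB _.
  have [s1 c1 m1] := ext _ _ sB mB.
  by exists false, (v |: B); split; rewrite // c1 cB.
Qed.

Lemma ramsey_ex (H : sgraph) : exists N, ramsey H N.
Proof.
have [N hN] := ramsey_clique #|H| #|H|; exists N; apply/forallP => c.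
have [|b [B [_ cB mB]]] := hN _ c [set: 'I_N]; first by rewrite cardsT card_ord.
have {}cB : #|H| = #|B| by rewrite cB if_same.
apply/existsP; exists b; apply/existsP.
pose f x := enum_val (cast_ord cB (enum_rank x)).
have f_inj : injective f.
  by move=> x y /enum_val_inj/cast_ord_inj/enum_rank_inj.
exists (finfun f); apply/andP; split.
  by apply/injectiveP=> x y; rewrite !ffunE => /f_inj.
apply/forallP=> x; apply/forallP=> y; apply/implyP=> exy; rewrite !ffunE /=.
have nxy : f x != f y.
  by rewrite (inj_eq f_inj); apply: contraTneq exy => ->; rewrite edge_irrefl.
by rewrite /color_edge /= nxy mB ?enum_valP /=.
Qed.

Definition ramsey_number (H : sgraph) : nat := ex_minn (ramsey_ex H).

(* Main.v *)
(* Write d_b(v) for the degree of v in colour b, and call an edge of colour b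
   heavy if one of its ends u has d_b(u) > n.  A copy of S(n,m) with central
   edge uv exists iff the degrees of u and v exceed n and m and the union of
   their neighbourhoods has at least n+m+2 elements.  In a colouring without monochromatic copy and with
   p >= n+2m+2, no vertex has colour-b degree at most m, so the two ends of every
   heavy edge of colour b have at least k = p-(n+m+1) common neighbours in the
   other colour.  If both colours had a vertex of degree above n, then, since
   p >= 2n+2, the vertices split into nonempty parts X and Y, with d_true > n
   on X and d_false > n on Y, so all X-Y edges are heavy.  Count triples
   (u,v,w) with u in X, v in Y such that wu and wv have the colour opposite
   to that of uv: there are at least k|X||Y|, while two vertices u, w of X and
   v in Y (or symmetrically) contribute at most once, and only if vu and vw
   have different colours, so there are at most
   |Y||X|^2/4 + |X||Y|^2/4.  Hence 4k <= p, which contradicts the bounds on p. *)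
Require Import Defs.
From mathcomp Require Import all_boot zify.

Set Implicit Arguments.
Unset Strict Implicit.
Unset Printing Implicit Defensive.

(** * Double counting of triples across a bipartition *)

Section CrossingPairs.
Variables (T : finType) (e : rel T).
Hypothesis e_sym : symmetric e.

(** If [u] and [w] are joined to [v] in different colours, exactly one of the orders [(u, w)],
    [(w, u)] is counted, depending on the colour of [uw]. So the sum is [r * b] with [r + b = #|Y|],
    and AM-GM applies. *)
Lemma odd_pairs_bound (Y : {set T}) (v : T) :
  4 * (\sum_(u in Y) \sum_(w in Y) ((e w u != e u v) && (e w v != e u v)))
    <= #|Y| ^ 2.
Proof.
set S := \sum_(u in Y) _.
pose r := \sum_(u in Y) e u v; pose b := \sum_(u in Y) ~~ e u v.
have cY : #|Y| = r + b.
  rewrite -sum1_card /r /b -big_split /=; apply: eq_bigr => u _.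
  by case: (e u v).
have SS : S + S = \sum_(u in Y) \sum_(w in Y) (e w v != e u v).
  rewrite {2}/S exchange_big -big_split /=; apply: eq_bigr => u _.
  rewrite -big_split /=; apply: eq_bigr => w _.
  by rewrite (e_sym u w); case: (e w u); case: (e u v); case: (e w v).
have rb : \sum_(u in Y) \sum_(w in Y) (e w v != e u v) = r * b + b * r.
  rewrite /r /b !big_distrl -big_split /=; apply: eq_bigr => u _.
  rewrite !big_distrr -big_split /=; apply: eq_bigr => w _.
  by case: (e u v); case: (e w v).
rewrite cY (leq_trans _ (nat_AGM2 r b)) //; lia.
Qed.

Lemma crossing_pairs_bound (X : {set T}) k :
    0 < #|X| -> 0 < #|~: X| ->
    (forall u v, u \in X -> v \in ~: X ->
       k <= #|[set w | (e w u != e u v) && (e w v != e u v)]|) ->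
  4 * k <= #|T|.
Proof.
move=> X_gt0 Y_gt0 hk; set Y := ~: X in Y_gt0 hk.
pose t u v w : nat := (e w u != e u v) && (e w v != e u v).
have lb : #|X| * (#|Y| * k) <= \sum_(u in X) \sum_(v in Y) \sum_w t u v w.
  rewrite -sum_nat_const leq_sum // => u uX.
  rewrite -sum_nat_const leq_sum // => v vY.
  apply: leq_trans (hk u v uX vY) _.
  by rewrite -sum1dep_card big_mkcond leq_sum // => w _; rewrite /t; case: ifP.
have splitE : \sum_(u in X) \sum_(v in Y) \sum_w t u v w =
    \sum_(v in Y) \sum_(u in X) \sum_(w in X) t u v w
    + \sum_(u in X) \sum_(v in Y) \sum_(w in Y) t u v w.
  rewrite [Z in _ = Z + _]exchange_big -big_split /=; apply: eq_bigr => u _.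
  rewrite -big_split /=; apply: eq_bigr => v _.
  rewrite (bigID (mem X)) /=; congr (_ + _).
  by apply: eq_bigl => w; rewrite inE.
have ub1 : 4 * (\sum_(v in Y) \sum_(u in X) \sum_(w in X) t u v w)
    <= #|Y| * #|X| ^ 2.
  rewrite big_distrr -sum_nat_const leq_sum // => v _; exact: odd_pairs_bound.
have ub2 : 4 * (\sum_(u in X) \sum_(v in Y) \sum_(w in Y) t u v w)
    <= #|X| * #|Y| ^ 2.
  rewrite big_distrr -sum_nat_const leq_sum // => u _.
  apply: leq_trans (odd_pairs_bound Y u); rewrite leq_mul2l leq_sum // => v _.
  by rewrite leq_sum // => w _; rewrite /t andbC (e_sym u v).
(* The bounds [ub1] and [ub2] add up to [#|X| * #|Y| * (#|X| + #|Y|)]; the first two factors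
   cancel. *)
have XY_gt0 : 0 < #|X| * #|Y| by rewrite muln_gt0 X_gt0.
by rewrite -(cardsC X) -/Y -(leq_pmul2l XY_gt0); nia.
Qed.

End CrossingPairs.

(** * Double stars in terms of degrees and neighbourhood unions *)

Lemma set_of_card (T : finType) (A : {set T}) k : k <= #|A| ->
  exists2 B : {set T}, B \subset A & #|B| = k.
Proof.
move=> le_kA; exists [set x in take k (enum A)].
  by apply/subsetP=> x; rewrite inE => /mem_take; rewrite mem_enum.
rewrite cardsE (card_uniqP _) ?take_uniq ?enum_uniq // size_takel //.
by rewrite -cardE.
Qed.

(** Greedy choice: [P] takes from [X :&: Y] at most a set [P'] that makes up the shortfall of
    [X :\: Y] (empty if there is none, by truncated subtraction), and [Q] avoids [P']. *)
Lemma disjoint_representatives (T : finType) (X Y : {set T}) n m :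
    n <= #|X| -> m <= #|Y| -> n + m <= #|X :|: Y| ->
  exists P Q : {set T},
    [/\ P \subset X, Q \subset Y, [disjoint P & Q], #|P| = n & #|Q| = m].
Proof.
move=> leX leY leXY.
have [P' sP' cP'] : exists2 B : {set T}, B \subset X :&: Y
    & #|B| = n - #|X :\: Y|.
  apply: set_of_card; have := cardsID Y X; lia.
have dP' : [disjoint X :\: Y & P'].
  rewrite disjoint_subset; apply/subsetP=> x; rewrite !inE => /andP[nY _].
  by apply: contra nY => /(subsetP sP'); rewrite inE => /andP[].
have [P sP cP] : exists2 B : {set T}, B \subset (X :\: Y) :|: P' & #|B| = n.
  apply: set_of_card; move: dP'; rewrite -leq_card_setU => /eqP ->; lia.
have sP'Y : P' \subset Y := subset_trans sP' (subsetIr _ _).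
have [Q sQ cQ] : exists2 B : {set T}, B \subset Y :\: P' & #|B| = m.
  apply: set_of_card; rewrite cardsDS //.
  by have := cardsUI X Y; have := cardsID Y X; lia.
exists P, Q; split=> //.
- apply: subset_trans sP _; rewrite subUset subsetDl.
  exact: subset_trans sP' (subsetIl _ _).
- exact: subset_trans sQ (subsetDl _ _).
- rewrite disjoint_subset; apply/subsetP=> x /(subsetP sP) xP; rewrite inE.
  apply/negP=> /(subsetP sQ); move: xP; rewrite !inE.
  by case: (x \in P'); case: (x \in Y).
Qed.

Lemma injection_of_card (T : finType) (P : {set T}) n : #|P| = n ->
  exists2 h : 'I_n -> T, injective h & forall i, h i \in P.
Proof.
move=> <-; exists enum_val; [exact: enum_val_inj | exact: enum_valP].
Qed.

Lemma has_copyP (H G : sgraph) :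
  reflect (exists2 f : H -> G, injective f &
             forall x y, edge x y -> edge (f x) (f y))
          (has_copy H G).
Proof.
apply: (iffP existsP) => [[f /andP[/injectiveP f_inj /forallP f_e]] | [f f_inj f_e]].
  by exists f => // x y; have /forallP/(_ y)/implyP := f_e x.
exists (finfun f); apply/andP; split.
  by apply/injectiveP=> x y; rewrite !ffunE => /f_inj.
by apply/forallP=> x; apply/forallP=> y; apply/implyP; rewrite !ffunE; apply: f_e.
Qed.

Lemma has_double_star (G : sgraph) n m (u v : G) :
    edge u v -> n < deg u -> m < deg v ->
    n + m + 2 <= #|nbhd u :|: nbhd v| ->
  has_copy (double_star n m) G.
Proof.
move=> uv ltu ltv le_uv.
have vu : edge v u by rewrite edge_sym.
have nuv : u != v by apply: contraTneq uv => ->; rewrite edge_irrefl.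
have [||| P [Q [sP sQ dPQ cP cQ]]] :=
    @disjoint_representatives _ (nbhd u :\ v) (nbhd v :\ u) n m.
- by move: ltu; rewrite /deg (cardsD1 v) inE uv.
- by move: ltv; rewrite /deg (cardsD1 u) inE vu.
(* Both centres lie in the union; removing them accounts for the 2 in [n + m + 2]. *)
- move: le_uv; rewrite (cardsD1 u) (cardsD1 v) !inE uv vu eq_sym nuv orbT.
  rewrite addn2 /= !add1n !ltnS => /leq_trans -> //; apply: subset_leq_card.
  apply/subsetP=> x; rewrite !inE => /and3P[-> ->].
  by rewrite !andTb.
have [h h_inj hP] := injection_of_card cP.
have [k k_inj kQ] := injection_of_card cQ.
have hE i : [/\ edge u (h i), h i != v & h i != u].
  have := subsetP sP _ (hP i); rewrite !inE => /andP[-> uh]; split=> //.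
  by apply: contraTneq uh => ->; rewrite edge_irrefl.
have kE i : [/\ edge v (k i), k i != u & k i != v].
  have := subsetP sQ _ (kQ i); rewrite !inE => /andP[-> vk]; split=> //.
  by apply: contraTneq vk => ->; rewrite edge_irrefl.
have hk i j : h i != k j.
  by apply: contraTneq (hP i) => ->; rewrite (disjointFl dPQ).
pose f (x : double_star n m) : G := match x with
  | inl None => u | inl (Some i) => h i
  | inr None => v | inr (Some j) => k j end.
apply/has_copyP; exists f.
  case=> [] [i|] [] [j|] //= eq_f.
  - by rewrite (h_inj _ _ eq_f).
  - by have [_ _ /eqP] := hE i.
  - by have /eqP := hk i j.
  - by have [_ /eqP] := hE i.
  - by have [_ _ /eqP] := hE j; case.
  - by have [_ /eqP] := kE j; case.
  - by rewrite eq_f eqxx in nuv.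
  - by have /eqP := hk j i; case.
  - by have [_ /eqP] := kE i.
  - by rewrite (k_inj _ _ eq_f).
  - by have [_ _ /eqP] := kE i.
  - by have [_ /eqP] := hE j; case.
  - by rewrite eq_f eqxx in nuv.
  - by have [_ _ /eqP] := kE j; case.
case=> [] [i|] [] [j|] //= _.
- by rewrite edge_sym; have [] := hE i.
- by have [] := hE j.
- by rewrite edge_sym; have [] := kE i.
- by have [] := kE j.
Qed.

Lemma double_star_copy_center (G : sgraph) n m :
    has_copy (double_star n m) G ->
  exists u v : G,
    [/\ edge u v, n < deg u & n + m + 2 <= #|nbhd u :|: nbhd v|].
Proof.
case/has_copyP=> f f_inj f_e; exists (f (inl None)), (f (inr None)).
have nuE x : x \in nbhd (inl None : double_star n m) -> f x \in nbhd (f (inl None)).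
  by rewrite !inE; apply: f_e.
have nvE x : x \in nbhd (inr None : double_star n m) -> f x \in nbhd (f (inr None)).
  by rewrite !inE; apply: f_e.
split.
- exact: f_e.
(* Here [None] stands for the other centre, which gives the degree [n.+1]. *)
- pose g (x : option 'I_n) : double_star n m :=
    if x is Some i then inl (Some i) else inr None.
  have g_inj : injective g by case=> [i|] [j|] // [->].
  have <- : #|[set f (g x) | x in [set: option 'I_n]]| = n.+1.
    by rewrite card_imset ?cardsT ?card_option ?card_ord //; apply: inj_comp.
  apply/subset_leq_card/subsetP=> _ /imsetP[x _ ->]; apply: nuE.
  by rewrite inE; case: x.
- have <- : #|[set f x | x in [set: double_star n m]]| = n + m + 2.
    by rewrite card_imset // cardsT card_sum !card_option !card_ord; lia.
  apply/subset_leq_card/subsetP=> _ /imsetP[x _ ->]; rewrite inE.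
  case: x => [] [i|]; first [by rewrite nuE ?inE | by rewrite nvE ?inE ?orbT].
Qed.

(** * Complements and the Ramsey property *)

Section Complement.
Variable G : sgraph.

Definition compl_edge : rel G := fun x y => (x != y) && ~~ edge x y.

Lemma compl_sym : symmetric compl_edge.
Proof. by move=> x y; rewrite /compl_edge eq_sym edge_sym. Qed.

Lemma compl_irrefl : irreflexive compl_edge.
Proof. by move=> x; rewrite /compl_edge eqxx. Qed.

Definition compl : sgraph := SGraph compl_sym compl_irrefl.

Lemma deg_compl (v : G) : (deg v + @deg compl v).+1 = #|G|.
Proof.
have vN : v \notin nbhd v by rewrite inE edge_irrefl.
rewrite -(cardsC (v |: nbhd v)) cardsU1 vN /deg add1n addSn.
congr (_ + _).+1; apply: eq_card => x.
by rewrite !inE negb_or eq_sym.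
Qed.

End Complement.

(** Only [N] vertices of [G] are coloured, by adjacency, so no separate monotonicity of [ramsey] in
    [N] is needed. *)
Lemma ramsey_has_copy (H G : sgraph) N : ramsey H N -> N <= #|G| ->
  has_copy H G \/ has_copy H (compl G).
Proof.
move=> /forallP hN leN.
pose phi (i : 'I_N) : G := enum_val (widen_ord leN i).
have phi_inj : injective phi.
  by move=> i j /enum_val_inj/(congr1 val) /= ?; apply: val_inj.
pose c : coloring N := [ffun A : {set 'I_N} =>
  [exists x in A, exists y in A, edge (phi x) (phi y)]].
have cE x y : c [set x; y] = edge (phi x) (phi y).
  rewrite ffunE; apply/exists_inP/idP => [[x' x'A /exists_inP[y' y'A]] | exy].
    move: x'A y'A; rewrite !inE => /orP[]/eqP-> /orP[]/eqP-> //;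
      by rewrite ?edge_irrefl // edge_sym.
  exists x; first by rewrite !inE eqxx.
  by apply/exists_inP; exists y; rewrite // !inE eqxx orbT.
have [[] /has_copyP[f f_inj f_e]] := existsP (hN c); [left | right];
  apply/has_copyP; exists (phi \o f); try exact: inj_comp.
- by move=> x y /f_e /andP[_ /eqP]; rewrite cE.
- move=> x y /f_e /andP[nxy /eqP]; rewrite cE /= /compl_edge => ->.
  by rewrite (inj_eq phi_inj) nxy.
Qed.

(** * Degrees in two-colourings without a monochromatic double star *)

Section TwoColoring.
Variables (T : finType) (e : rel T).
Hypothesis e_sym : symmetric e.

Definition color_nbhd (b : bool) (v : T) : {set T} := [set u | (v != u) && (e v u == b)].

Local Notation nb := color_nbhd.

Lemma color_nbhd_sym b u v : (u \in nb b v) = (v \in nb b u).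
Proof. by rewrite !inE eq_sym e_sym. Qed.

Lemma color_nbhd_irrefl b v : v \notin nb b v.
Proof. by rewrite inE eqxx. Qed.

Lemma in_color_nbhdN b u v : (u \in nb (~~ b) v) = (u != v) && (u \notin nb b v).
Proof.
rewrite !inE (eq_sym u); case: (v == u) => //=.
by case: b; case: (e v u).
Qed.

Lemma card_color_nbhd b v : (#|nb b v| + #|nb (~~ b) v|).+1 = #|T|.
Proof.
rewrite -(cardsC (v |: nb b v)) cardsU1 color_nbhd_irrefl add1n addSn.
by congr (_ + _).+1; apply: eq_card => u; rewrite in_color_nbhdN !inE negb_or.
Qed.

Variables n m : nat.
Hypotheses (le_mn : m <= n) (T_ge1 : 2 * n + 2 <= #|T|).
Hypothesis T_ge2 : n + 2 * m + 2 <= #|T|.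
Hypothesis color_union_le : forall b u v,
  v \in nb b u -> n < #|nb b u| -> m < #|nb b v| ->
  #|nb b u :|: nb b v| <= n + m + 1.

(** Otherwise [y], a neighbour of [z], and its at least [#|T| - 1 - m] neighbours in the colour
    [~~ b] give a union of size at least [n + m + 2]. *)
Lemma low_degree_nbhd b y z : #|nb b y| <= m -> z \in nb (~~ b) y ->
  #|nb (~~ b) z| <= m.
Proof.
move=> le_y yz; rewrite leqNgt; apply/negP=> lt_z.
have dy := card_color_nbhd b y.
have lt_y : n < #|nb (~~ b) y| by lia.
have := color_union_le yz lt_y lt_z; apply/negP; rewrite -ltnNge.
have -> : n + m + 1 < #|nb (~~ b) y :|: nb (~~ b) z|.
  have : #|y |: nb (~~ b) y| <= #|nb (~~ b) y :|: nb (~~ b) z|.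
    apply/subset_leq_card; rewrite setUC subUset subsetUl sub1set inE.
    by rewrite (color_nbhd_sym _ y z) yz orbT.
  by rewrite cardsU1 color_nbhd_irrefl; lia.
by [].
Qed.

(** If [y] fails, [z] has low degree in the colour [~~ b]. A neighbour [x] of [y] in that colour not
    joined to [z] by it would be low in both colours, impossible as [#|T| > 2 * m + 1]; so [z]
    inherits nearly all neighbours of [y], too many. *)
Lemma color_degree_gt b y : m < #|nb b y|.
Proof.
rewrite ltnNge; apply/negP=> le_y.
have dy := card_color_nbhd b y.
have /card_gt0P[z yz] : 0 < #|nb (~~ b) y| by lia.
have le_z := low_degree_nbhd le_y yz.
have : #|y |: (nb (~~ b) y :\ z)| <= #|nb (~~ b) z|.
  apply/subset_leq_card/subsetP=> x; rewrite !inE -/(nb _ _) => /orP[/eqP->|].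
    by move: yz; rewrite inE eq_sym e_sym.
  case/andP=> nxz yx; apply/idPn=> zx.
  have {}zx : x \in nb (~~ ~~ b) z by rewrite in_color_nbhdN nxz inE.
  have := low_degree_nbhd le_z zx; rewrite negbK => le_x'.
  have le_x : #|nb (~~ b) x| <= m by apply: low_degree_nbhd le_y _; rewrite inE.
  by have := card_color_nbhd b x; lia.
rewrite cardsU1 !inE eqxx /= => le_yz.
by have := cardsD1 z (nb (~~ b) y); rewrite yz; lia.
Qed.

(** Since [u] and [v] lie in the union themselves, its complement is exactly the common
    neighbourhood in the other colour. *)
Lemma common_nbhd_ge b u v : v \in nb b u -> n < #|nb b u| ->
  #|T| - (n + m + 1) <= #|nb (~~ b) u :&: nb (~~ b) v|.
Proof.
move=> uv ltu; have := color_union_le uv ltu (color_degree_gt b v).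
have := cardsC (nb b u :|: nb b v).
suff -> : ~: (nb b u :|: nb b v) = nb (~~ b) u :&: nb (~~ b) v by lia.
apply/setP=> w; rewrite in_setC in_setU in_setI !in_color_nbhdN negb_or.
case: (w =P u) => [->|_]; first by rewrite (color_nbhd_sym _ u v) uv andbF.
by case: (w =P v) => [->|_]; rewrite ?uv.
Qed.

Lemma one_color_low_degree : exists b, forall v, #|nb (~~ b) v| <= n.
Proof.
have high v : (n < #|nb true v|) || (n < #|nb false v|).
  have : (#|nb true v| + #|nb false v|).+1 = #|T| := card_color_nbhd true v.
  by lia.
pose A b := [set v | n < #|nb b v|].
case: (set_0Vmem (A false)) => [A0|[y yA]].
  exists true => v; rewrite leqNgt.
  by apply/negP=> ltv; have := in_set0 v; rewrite -A0 inE ltv.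
case: (set_0Vmem (A true)) => [A0|[x xA]].
  exists false => v; rewrite leqNgt.
  by apply/negP=> ltv; have := in_set0 v; rewrite -A0 inE ltv.
have cover v : (v \in A true) || (v \in A false) by rewrite !inE high.
have [X [X_gt0 XC_gt0 sXA sXCA]] : exists X : {set T},
    [/\ 0 < #|X|, 0 < #|~: X|, X \subset A true & ~: X \subset A false].
  (* [A true] serves as [X] unless its complement is empty; then [y] alone is split off. *)
  have [AT|] := eqVneq (A true) setT.
    exists (~: [set y]); rewrite setCK cards1 sub1set AT subsetT; split=> //.
    by have := cardsC [set y]; rewrite cards1; lia.
  move=> nAT; exists (A true); split=> //.
  - by apply/card_gt0P; exists x.
  - rewrite card_gt0; apply: contra nAT => /eqP AC0.
    by rewrite -(setCK (A true)) AC0 setC0.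
  - by apply/subsetP=> v; rewrite inE; have := cover v; case: (v \in A true).
have crossing u v : u \in X -> v \in ~: X ->
    #|T| - (n + m + 1) <= #|[set w | (e w u != e u v) && (e w v != e u v)]|.
  move=> uX vX.
  have nuv : u != v by apply: contraTneq uX => ->; rewrite inE in vX.
  have uv : v \in nb (e u v) u by rewrite inE nuv eqxx.
  have le_common : #|T| - (n + m + 1) <=
      #|nb (~~ e u v) u :&: nb (~~ e u v) v|.
    case E: (e u v) in uv *.
      apply: common_nbhd_ge uv _.
      by have := subsetP sXA u uX; rewrite inE.
    rewrite setIC; apply: common_nbhd_ge; first by rewrite color_nbhd_sym.
    by have := subsetP sXCA v vX; rewrite inE.
  apply: leq_trans le_common _; apply/subset_leq_card/subsetP=> w.
  rewrite !inE (e_sym u w) (e_sym v w).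
  by case/andP=> /andP[_ /eqP->] /andP[_ /eqP->]; case: (e u v).
(* This would give [3 * #|T| <= 4 * (n + m + 1)], but [T_ge1] plus twice [T_ge2] gives
   [3 * #|T| >= 4 * n + 4 * m + 6]. *)
have := crossing_pairs_bound e_sym X_gt0 XC_gt0 crossing; lia.
Qed.

End TwoColoring.

Theorem theorem2p4 (n m p : nat) (hmn : m <= n)
    (hp : maxn (2 * n + 2) (n + 2 * m + 2) <= p) :
  p < ramsey_number (double_star n m) <->
  exists G : sgraph,
    [/\ #|G| = p,
        (forall v : G, p - n - 1 <= deg v) &
        (forall u v : G, edge u v -> #|nbhd v :|: nbhd u| <= n + m + 1)].
Proof.
have [p_ge1 p_ge2] : 2 * n + 2 <= p /\ n + 2 * m + 2 <= p.
  by move: hp; rewrite geq_max => /andP[].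
rewrite /ramsey_number; case: ex_minnP => q ramsey_q min_q; split.
  move=> lt_pq; have /forallPn[c] : ~~ ramsey (double_star n m) p.
    by apply/negP=> /min_q; rewrite leqNgt lt_pq.
  rewrite negb_exists => /forallP no_copy.
  pose e (x y : 'I_p) := c [set x; y].
  have e_sym : symmetric e by move=> x y; rewrite /e setUC.
  have union_le b u v : v \in color_nbhd e b u -> n < #|color_nbhd e b u| ->
      m < #|color_nbhd e b v| ->
      #|color_nbhd e b u :|: color_nbhd e b v| <= n + m + 1.
    rewrite inE => uv ltu ltv; rewrite leqNgt; apply: contra (no_copy b) => lt_uv.
    by apply: (@has_double_star (color_class c b) n m u v) => //; rewrite addnS.
  have cT : #|'I_p| = p := card_ord p.
  have [||b low] := one_color_low_degree e_sym hmn _ _ union_le; rewrite ?cT //.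
  (* As [p - n - 1 >= n + 1], all degrees in colour [b] exceed [n] and [m], so [union_le] applies to
     every edge of that colour. *)
  have deg_ge v : p - n - 1 <= #|color_nbhd e b v|.
    by have := card_color_nbhd e b v; have := low v; rewrite cT; lia.
  exists (color_class c b); split; [exact: cT | exact: deg_ge | ].
  move=> u v uv; rewrite setUC.
  apply: (union_le b u v).
  - by rewrite inE.
  - by have := deg_ge u; lia.
  - by have := deg_ge v; lia.
(* The union bound excludes a copy in [G]; degrees at most [n] exclude one in the complement. *)
case=> G [cG deg_ge union_le]; rewrite ltnNge; apply/negP=> le_qp.
have [||] := @ramsey_has_copy (double_star n m) G q ramsey_q; first by rewrite cG.
- case/double_star_copy_center=> u [v [uv _]]; have := union_le u v uv.
  by rewrite setUC; lia.
- case/double_star_copy_center=> u [v [_ ltu _]].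
  by have := @deg_compl G u; have := deg_ge u; rewrite cG; move: ltu; lia.
Qed.
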